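(* Let $(B,\diamond)$ be a Zinbiel algebra, $(D,\dashv,\vdash,\omega)$ a quadratic diassociative algebra, and $(D\otimes B,\cdot)$ the induced associative algebra, $(d_1\otimes b_1)\cdot(d_2\otimes b_2)=(d_1\vdash d_2)\otimes(b_1\diamond b_2)+(d_1\dashv d_2)\otimes(b_2\diamond b_1)$. Suppose $r=\sum_ix_i\otimes y_i\in B\otimes B$ is a solution of the Zinbiel Yang-Baxter equation in $(B,\diamond)$. If $r-\tau(r)$ is Zinb-invariant, then $$\widehat r:=\sum_{i,j}(e_j\otimes x_i)\otimes(f_j\otimes y_i)\in(D\otimes B)\otimes(D\otimes B)$$ is a solution of the associative Yang-Baxter equation in $(D\otimes B,\cdot)$ and $\widehat r+\tau(\widehat r)$ is ass-invariant, where $\{e_1,\dots,e_n\}$ is a basis of $D$ and $\{f_1,\dots,f_n\}$ its dual basis with respect to $\omega$ ($\omega(f_i,e_j)=\delta_{ij}$). In particular, $\widehat r$ is a skew-symmetric solution of the associative Yang-Baxter equation in $(D\otimes B,\cdot)$ if $r$ is a symmetric solution of the Zinbiel Yang-Baxter equation in $(B,\diamond)$.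
   Context: All vector spaces are finite-dimensional over a field $\Bbbk$ of characteristic zero; $\tau(x\otimes y)=y\otimes x$; symmetric: $\tau(s)=s$, skew-symmetric: $\tau(s)=-s$. Zinbiel algebra $(B,\diamond)$: $b_1\diamond(b_2\diamond b_3)=(b_1\diamond b_2)\diamond b_3+(b_2\diamond b_1)\diamond b_3$; $\bar{\mathbf l}_B(b)(x)=b\diamond x$, $\bar{\mathbf r}_B(b)(x)=x\diamond b$. The Zinbiel Yang-Baxter equation for $r=\sum_ix_i\otimes y_i$ is $\sum_{i,j}\big((x_i\diamond y_j)\otimes x_j\otimes y_i+(y_i\diamond x_j)\otimes x_i\otimes y_j+x_i\otimes(y_i\diamond x_j)\otimes y_j+x_j\otimes(x_i\diamond y_j)\otimes y_i-x_i\otimes x_j\otimes(y_i\diamond y_j)-x_j\otimes x_i\otimes(y_i\diamond y_j)-(x_i\diamond x_j)\otimes y_j\otimes y_i-y_j\otimes(x_i\diamond x_j)\otimes y_i\big)=0$. An element $s\in B\otimes B$ is Zinb-invariant if $\big(\bar{\mathbf l}_B(b)\otimes\mathrm{id}-\mathrm{id}\otimes(\bar{\mathbf l}_B+\bar{\mathbf r}_B)(b)\big)(s)=0$ for all $b\in B$. Diassociative algebra $(D,\dashv,\vdash)$: two associative products with $(d_1\dashv d_2)\dashv d_3=d_1\dashv(d_2\vdash d_3)$, $(d_1\vdash d_2)\dashv d_3=d_1\vdash(d_2\dashv d_3)$, $(d_1\dashv d_2)\vdash d_3=(d_1\vdash d_2)\vdash d_3$. Quadratic: with a skew-symmetric nondegenerate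 form $\omega$ such that $\omega(d_1\vdash d_2,d_3)=\omega(d_1,d_2\vdash d_3-d_2\dashv d_3)$ and $\omega(d_1\dashv d_2,d_3)=\omega(d_1,d_2\vdash d_3)$. For an associative algebra $(A,\cdot)$ and $s=\sum u_i\otimes v_i\in A\otimes A$, the associative Yang-Baxter equation is $\sum_{i,j}\big((u_i\cdot u_j)\otimes v_i\otimes v_j+u_i\otimes u_j\otimes(v_i\cdot v_j)-u_j\otimes(u_i\cdot v_j)\otimes v_i\big)=0$; $s$ is ass-invariant if $\sum_i\big(u_i\otimes(a\cdot v_i)-(u_i\cdot a)\otimes v_i\big)=0$ for all $a\in A$. *)

(* Defs.v *)
From HB Require Import structures.
From mathcomp Require Import all_boot all_order all_algebra.
Set Implicit Arguments.
Unset Strict Implicit.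
Unset Printing Implicit Defensive.
Import GRing.Theory.
Local Open Scope ring_scope.

Reserved Notation "x ⊗ y" (at level 40, left associativity).
Reserved Notation "x ◇ y" (at level 40, left associativity).
Reserved Notation "x ⊢ y" (at level 40, left associativity).
Reserved Notation "x ⊣ y" (at level 40, left associativity).
Reserved Notation "x • y" (at level 40, left associativity).

(* The tensor product V ⊗ W of finite-dimensional spaces is realized by
   coordinate matrices with respect to the standard bases of V and W, the pure
   tensor x ⊗ y being the outer product of coordinate vectors.  The universal
   property is tlift_tens and tensor_ext together with the linearity of tlift. *)
Definition tensor (K : fieldType) (V W : vectType K) : Type :=
  'M[K]_(dim V, dim W).

HB.instance Definition _ (K : fieldType) (V W : vectType K) :=
  Vector.copy (tensor V W) 'M[K]_(dim V, dim W).

Definition vecb (K : fieldType) (V : vectType K) (i : 'I_(dim V)) : V :=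
  VectorInternalTheory.r2v (delta_mx 0 i).

Definition tens (K : fieldType) (V W : vectType K) (x : V) (y : W) :
  tensor V W :=
  (VectorInternalTheory.v2r x)^T *m VectorInternalTheory.v2r y.

Notation "x ⊗ y" := (tens x y) : ring_scope.

(* Meaningful for bilinear g only: the induced linear map V ⊗ W -> U. *)
Definition tlift (K : fieldType) (V W U : vectType K) (g : V -> W -> U)
    (t : tensor V W) : U :=
  \sum_i \sum_j (t i j : K) *: g (vecb i) (vecb j).

Section TensorTheory.
Variables (K : fieldType) (V W U : vectType K).
Import VectorInternalTheory.

Lemma tens_is_bilinear : bilinear_for
  (GRing.Scale.Law.clone _ _ *:%R _) (GRing.Scale.Law.clone _ _ *:%R _)
  (@tens K V W).
Proof.
split=> [y|x] a u v /=; rewrite /tens linearP /=.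
- by rewrite linearP /= mulmxDl scalemxAl.
- by rewrite mulmxDr scalemxAr.
Qed.

HB.instance Definition _ := bilinear_isBilinear.Build K V W (tensor V W)
  _ _ (@tens K V W) tens_is_bilinear.

Lemma tlift_is_linear (g : V -> W -> U) : linear (tlift g).
Proof.
move=> a s t; rewrite /tlift scaler_sumr -big_split; apply: eq_bigr => i _ /=.
rewrite scaler_sumr -big_split; apply: eq_bigr => j _ /=.
by rewrite !mxE scalerDl scalerA.
Qed.

HB.instance Definition _ (g : V -> W -> U) :=
  GRing.isLinear.Build K (tensor V W) U _ (tlift g) (tlift_is_linear g).

Lemma tlift_fun a (g h k : V -> W -> U) t :
  (forall x y, g x y = a *: h x y + k x y) ->
  tlift g t = a *: tlift h t + tlift k t.
Proof.
move=> ghk; rewrite /tlift scaler_sumr -big_split; apply: eq_bigr => i _ /=.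
rewrite scaler_sumr -big_split; apply: eq_bigr => j _ /=.
by rewrite ghk scalerDr !scalerA mulrC.
Qed.

Lemma vecb_sum (X : vectType K) (x : X) : x = \sum_i v2r x 0 i *: vecb i.
Proof.
rewrite -{1}(v2rK x) {1}(row_sum_delta (v2r x)) linear_sum /=.
by apply: eq_bigr => i _; rewrite linearZ.
Qed.

Lemma tlift_tens (g : V -> W -> U) x y :
    (forall y, linear (g^~ y)) -> (forall x, linear (g x)) ->
  tlift g (x ⊗ y) = g x y.
Proof.
move=> gl gr.
pose gb : {bilinear V -> W -> U} := HB.pack g
  (@bilinear_isBilinear.Build K V W U (GRing.Scale.Law.clone _ _ *:%R _)
     (GRing.Scale.Law.clone _ _ *:%R _) g (gl, gr)).
rewrite /tlift -[g]/(gb : V -> W -> U) {2}(vecb_sum x) {2}(vecb_sum y).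
rewrite linear_sumlz; apply: eq_bigr => i _.
rewrite linear_sumr; apply: eq_bigr => j _.
by rewrite linearZl_LR linearZr_LR scalerA !mxE big_ord1 !mxE.
Qed.

Lemma tlift_sum (g : V -> W -> U) n (x : 'I_n -> V) (y : 'I_n -> W) :
    (forall y, linear (g^~ y)) -> (forall x, linear (g x)) ->
  tlift g (\sum_i x i ⊗ y i) = \sum_i g (x i) (y i).
Proof.
move=> gl gr; rewrite linear_sum; apply: eq_bigr => i _.
exact: tlift_tens.
Qed.

Lemma tensor_sum (t : tensor V W) :
  t = \sum_i \sum_j (t i j : K) *: (vecb i ⊗ vecb j).
Proof.
rewrite {1}(matrix_sum_delta t); apply: eq_bigr => i _; apply: eq_bigr => j _.
congr (_ *: _); rewrite /tens /vecb !r2vK; apply/matrixP=> k l.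
by rewrite !mxE big_ord1 !mxE eqxx -natrM mulnb.
Qed.

Lemma tensor_ext (g h : tensor V W -> U) : linear g -> linear h ->
  (forall x y, g (x ⊗ y) = h (x ⊗ y)) -> g =1 h.
Proof.
move=> gl hl gh t.
pose gL : {linear tensor V W -> U} := HB.pack g (GRing.isLinear.Build _ _ _ _ g gl).
pose hL : {linear tensor V W -> U} := HB.pack h (GRing.isLinear.Build _ _ _ _ h hl).
rewrite -[g]/(gL : _ -> _) -[h]/(hL : _ -> _) (tensor_sum t) !linear_sum.
apply: eq_bigr => i _; rewrite !linear_sum; apply: eq_bigr => j _.
by rewrite !linearZ /= gh.
Qed.

End TensorTheory.

Section LinearClosure.
Variables (K : fieldType) (X V W U : vectType K).

Lemma lin_add (g h : X -> U) : linear g -> linear h ->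
  linear (fun x => g x + h x).
Proof. by move=> gl hl a x y; rewrite gl hl scalerDr addrACA. Qed.

Lemma lin_opp (g : X -> U) : linear g -> linear (fun x => - g x).
Proof. by move=> gl a x y; rewrite gl opprD scalerN. Qed.

Lemma lin_bil (b : {bilinear V -> W -> U}) (g : X -> V) w : linear g ->
  linear (fun x => b (g x) w).
Proof. by move=> gl a x y; rewrite gl linearPl. Qed.

Lemma lin_bir (b : {bilinear V -> W -> U}) (g : X -> W) v : linear g ->
  linear (fun x => b v (g x)).
Proof. by move=> gl a x y; rewrite gl linearPr. Qed.

Lemma lin_tens_l (g : X -> V) (w : W) : linear g ->
  linear (fun x => g x ⊗ w).
Proof. by move=> gl a x y; rewrite gl linearPl. Qed.

Lemma lin_tens_r (g : X -> W) (v : V) : linear g ->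
  linear (fun x => v ⊗ g x).
Proof. by move=> gl a x y; rewrite gl linearPr. Qed.

Lemma lin_tlift (g : X -> V -> W -> U) t : (forall v w, linear (fun x => g x v w)) ->
  linear (fun x => tlift (g x) t).
Proof. by move=> gl a x y; apply: tlift_fun => v w; exact: gl. Qed.

Lemma lin_id : linear (fun x : X => x).
Proof. by []. Qed.

End LinearClosure.

Ltac lin := repeat first [ exact: lin_id | apply: lin_add | apply: lin_opp
  | apply: lin_tens_l | apply: lin_tens_r | apply: lin_bil | apply: lin_bir
  | (apply: lin_tlift => ? ?) ].

Definition tau (K : fieldType) (V W : vectType K) :
  tensor V W -> tensor W V := tlift (fun x y => y ⊗ x).

Lemma tau_sum (K : fieldType) (V W : vectType K) n
    (x : 'I_n -> V) (y : 'I_n -> W) :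
  tau (\sum_i x i ⊗ y i) = \sum_i y i ⊗ x i.
Proof. by rewrite /tau tlift_sum // => z; lin. Qed.

Definition tmap (K : fieldType) (V W V' W' : vectType K)
    (g : V -> V') (h : W -> W') : tensor V W -> tensor V' W' :=
  tlift (fun x y => g x ⊗ h y).

HB.mixin Record isZinbiel (K : fieldType) B of Vector K B := {
  zmul : {bilinear B -> B -> B};
  zmulA : forall a b c : B,
    zmul a (zmul b c) = zmul (zmul a b) c + zmul (zmul b a) c
}.
#[short(type="zinbielType")]
HB.structure Definition Zinbiel (K : fieldType) :=
  {B of isZinbiel K B & Vector K B}.
Notation "x ◇ y" := (zmul x y) : ring_scope.

HB.mixin Record isDiass (K : fieldType) D of Vector K D := {
  dleft : {bilinear D -> D -> D};
  dright : {bilinear D -> D -> D};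
  dleftA : associative dleft;
  drightA : associative dright;
  dleft_left : forall a b c : D,
    dleft (dleft a b) c = dleft a (dright b c);
  dright_left : forall a b c : D,
    dleft (dright a b) c = dright a (dleft b c);
  dleft_right : forall a b c : D,
    dright (dleft a b) c = dright (dright a b) c
}.
#[short(type="diassType")]
HB.structure Definition Diass (K : fieldType) :=
  {D of isDiass K D & Vector K D}.
Notation "x ⊣ y" := (dleft x y) : ring_scope.
Notation "x ⊢ y" := (dright x y) : ring_scope.

Lemma nondegenerateP (K : fieldType) (D : vectType K)
    (w : {skew_symmetric D}) :
  nondegenerate w <-> forall x : D, (forall y, w x y = 0) -> x = 0.
Proof.
split=> [/eqP wD x wx|wD].
  apply/eqP; rewrite -memv0 -wD; apply/mem_orthovP => y _; exact: wx.
apply/eqP/vspaceP => x; rewrite memv0.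
apply/mem_orthovP/eqP => [wx|-> y _]; last by rewrite linear0l.
by apply: wD => y; apply: wx; rewrite memvf.
Qed.

HB.mixin Record isQuadraticDiass (K : fieldType) D of Diass K D := {
  omega : {skew_symmetric D};
  omega_nondegenerate : nondegenerate omega;
  omega_right : forall a b c : D,
    omega (a ⊢ b) c = omega a (b ⊢ c - b ⊣ c);
  omega_left : forall a b c : D, omega (a ⊣ b) c = omega a (b ⊢ c)
}.
#[short(type="quadraticDiassType")]
HB.structure Definition QuadraticDiass (K : fieldType) :=
  {D of isQuadraticDiass K D & Diass K D}.

(* Associative algebras are not assumed unital. *)
HB.mixin Record isAssAlg (K : fieldType) A of Vector K A := {
  amul : {bilinear A -> A -> A};
  amulA : associative amul
}.
#[short(type="assAlgType")]
HB.structure Definition AssAlg (K : fieldType) :=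
  {A of isAssAlg K A & Vector K A}.
Notation "x • y" := (amul x y) : ring_scope.

Section Induced.
Variables (K : fieldType) (D : diassType K) (B : zinbielType K).

(* The unique bilinear extension of
   (d1 ⊗ b1) • (d2 ⊗ b2) = (d1 ⊢ d2) ⊗ (b1 ◇ b2) + (d1 ⊣ d2) ⊗ (b2 ◇ b1),
   see ind_mul_tens. *)
Definition ind_mul (s t : tensor D B) : tensor D B :=
  tlift (fun d1 b1 =>
    tlift (fun d2 b2 => (d1 ⊢ d2) ⊗ (b1 ◇ b2) + (d1 ⊣ d2) ⊗ (b2 ◇ b1)) t) s.

Lemma ind_mul_is_bilinear : bilinear_for
  (GRing.Scale.Law.clone _ _ *:%R _) (GRing.Scale.Law.clone _ _ *:%R _)
  ind_mul.
Proof.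
split=> [t|s] a u v; rewrite /ind_mul; first by rewrite linearP.
by apply: tlift_fun => x y; rewrite linearP.
Qed.

HB.instance Definition _ := bilinear_isBilinear.Build K
  (tensor D B) (tensor D B) (tensor D B) _ _ ind_mul ind_mul_is_bilinear.

Lemma ind_mul_tens d1 b1 d2 b2 :
  ind_mul (d1 ⊗ b1) (d2 ⊗ b2) =
  (d1 ⊢ d2) ⊗ (b1 ◇ b2) + (d1 ⊣ d2) ⊗ (b2 ◇ b1).
Proof.
have inner e c : tlift (fun d2 b2 =>
    (e ⊢ d2) ⊗ (c ◇ b2) + (e ⊣ d2) ⊗ (b2 ◇ c)) (d2 ⊗ b2) =
    (e ⊢ d2) ⊗ (c ◇ b2) + (e ⊣ d2) ⊗ (b2 ◇ c).
  apply: tlift_tens => [y|x] a u v.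
  - by rewrite !(linearPl, linearPr) /= scalerDr addrACA.
  - by rewrite !(linearPl, linearPr) /= scalerDr addrACA.
rewrite /ind_mul tlift_tens => [|y|x]; first exact: inner.
- move=> a u v; rewrite !inner.
  by rewrite !(linearPl, linearPr) /= scalerDr addrACA.
- move=> a u v; rewrite !inner.
  by rewrite !(linearPl, linearPr) /= scalerDr addrACA.
Qed.

Lemma ind_mulA : associative ind_mul.
Proof.
move=> s t u; move: s.
apply: tensor_ext => [a s s'|a s s'|d1 b1]; rewrite ?linearPl //.
move: t; apply: tensor_ext => [a s s'|a s s'|d2 b2].
- by rewrite linearPl linearPr.
- by rewrite linearPr linearPl.
move: u; apply: tensor_ext => [a s s'|a s s'|d3 b3]; rewrite ?linearPr //.
rewrite !ind_mul_tens linearDr linearDl /= !ind_mul_tens.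
rewrite (zmulA b1 b3 b2) (zmulA b3 b1 b2) (addrC ((b3 ◇ b1) ◇ b2)).
rewrite -dleft_left dright_left dleft_right drightA dleftA.
rewrite (zmulA b1 b2 b3) (zmulA b3 b2 b1) !(linearDr _ (_ ⊢ _)).
rewrite !(linearDr _ (_ ⊣ _)) /=.
by rewrite [LHS](AC (3*3) (1*(4*5)*(2*(6*3)))).
Qed.

HB.instance Definition _ :=
  isAssAlg.Build K (tensor D B) ind_mulA.

End Induced.

Section YangBaxter.
Variable K : fieldType.

(* For r = \sum_i x_i ⊗ y_i the two nested lifts of r run over pairs
   (x, y) = (x_i, y_i) and (x', y') = (x_j, y_j); see zybe_lhs_sum. *)
Definition zybe_lhs (B : zinbielType K) (r : tensor B B) :
    tensor (tensor B B) B :=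
  tlift (fun x y : B => tlift (fun x' y' : B =>
      (x ◇ y') ⊗ x' ⊗ y + (y ◇ x') ⊗ x ⊗ y'
    + x ⊗ (y ◇ x') ⊗ y' + x' ⊗ (x ◇ y') ⊗ y
    - x ⊗ x' ⊗ (y ◇ y') - x' ⊗ x ⊗ (y ◇ y')
    - (x ◇ x') ⊗ y' ⊗ y - y' ⊗ (x ◇ x') ⊗ y) r) r.

Lemma zybe_lhs_sum (B : zinbielType K) n (x y : 'I_n -> B) :
  zybe_lhs (\sum_i x i ⊗ y i) = \sum_i \sum_j
    (  (x i ◇ y j) ⊗ x j ⊗ y i + (y i ◇ x j) ⊗ x i ⊗ y j
     + x i ⊗ (y i ◇ x j) ⊗ y j + x j ⊗ (x i ◇ y j) ⊗ y i
     - x i ⊗ x j ⊗ (y i ◇ y j) - x j ⊗ x i ⊗ (y i ◇ y j)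
     - (x i ◇ x j) ⊗ y j ⊗ y i - y j ⊗ (x i ◇ x j) ⊗ y i).
Proof.
rewrite /zybe_lhs tlift_sum => [|w|w]; [|lin..].
by apply: eq_bigr => i _; rewrite tlift_sum // => w; lin.
Qed.

Definition zybe (B : zinbielType K) (r : tensor B B) : Prop :=
  zybe_lhs r = 0.

Definition aybe_lhs (A : assAlgType K) (s : tensor A A) :
    tensor (tensor A A) A :=
  tlift (fun u v : A => tlift (fun u' v' : A =>
    (u • u') ⊗ v ⊗ v' + u ⊗ u' ⊗ (v • v') - u' ⊗ (u • v') ⊗ v) s) s.

Lemma aybe_lhs_sum (A : assAlgType K) n (u v : 'I_n -> A) :
  aybe_lhs (\sum_i u i ⊗ v i) = \sum_i \sum_j
    (  (u i • u j) ⊗ v i ⊗ v j + u i ⊗ u j ⊗ (v i • v j)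
     - u j ⊗ (u i • v j) ⊗ v i).
Proof.
rewrite /aybe_lhs tlift_sum => [|w|w]; [|lin..].
by apply: eq_bigr => i _; rewrite tlift_sum // => w; lin.
Qed.

Definition aybe (A : assAlgType K) (s : tensor A A) : Prop :=
  aybe_lhs s = 0.

Definition zinb_invariant (B : zinbielType K) (s : tensor B B) : Prop :=
  forall b : B,
    let l := fun x : B => b ◇ x in
    let r := fun x : B => x ◇ b in
    tmap l id s - tmap id (fun x => l x + r x) s = 0.

Definition ass_invariant (A : assAlgType K) (s : tensor A A) : Prop :=
  forall a : A, tlift (fun u v : A => u ⊗ (a • v) - (u • a) ⊗ v) s = 0.

Lemma ass_invariant_sum (A : assAlgType K) n (u v : 'I_n -> A) :
  ass_invariant (\sum_i u i ⊗ v i) <->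
  forall a : A, \sum_i (u i ⊗ (a • v i) - (u i • a) ⊗ v i) = 0.
Proof.
by split=> h a; move: (h a); rewrite tlift_sum // => w; lin.
Qed.

End YangBaxter.

(* Main.v *)
(* Each factor f_p of the Casimir element sum_p e_p ⊗ f_p can be traded for its
   omega-adjoint acting on e_p, and the Casimir element is skew-symmetric.  So
   every D-component of the Yang-Baxter expression of rhat reduces to one of
     R = sum_(p,q) (e_p ⊢ e_q) ⊗ f_p ⊗ f_q,
     L = sum_(p,q) (e_p ⊣ e_q) ⊗ f_p ⊗ f_q.
   Write Z for the left-hand side of the Zinbiel equation of r.  The coefficient
   of R is Z plus one instance of the invariance of r - tau r, and the
   coefficient of L is Z with its last two tensor factors exchanged plus two
   instances of this invariance. *)
Require Import Defs.
From mathcomp Require Import all_boot all_order all_algebra.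
From mathcomp Require Import ring.
Set Implicit Arguments.
Unset Strict Implicit.
Unset Printing Implicit Defensive.
Import GRing.Theory.
Local Open Scope ring_scope.
Import VectorInternalTheory.

(** * Multilinearity as a predicate on bare functions, and coordinatewise vector identities *)

Definition bilin (K : fieldType) (V W U : vectType K) (h : V -> W -> U) : Prop :=
  (forall w, linear (h^~ w)) /\ (forall v, linear (h v)).

Definition trilin (K : fieldType) (V1 V2 V3 U : vectType K)
    (G : V1 -> V2 -> V3 -> U) : Prop :=
  (forall c, bilin (fun a b => G a b c)) /\ (forall a b, linear (G a b)).

Lemma v2rD_entry (K : fieldType) (V : vectType K) (u v : V) k :
  v2r (u + v) 0 k =
  v2r u 0 k + v2r v 0 k.
Proof. by rewrite linearD mxE. Qed.

Lemma v2rN_entry (K : fieldType) (V : vectType K) (u : V) k :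
  v2r (- u) 0 k = - v2r u 0 k.
Proof. by rewrite linearN mxE. Qed.

(* [ring] does not handle identities between vectors, so they are checked
   coordinatewise. *)
Ltac vect_ring := apply: (v2r_inj); apply/rowP=> ?;
  rewrite !(v2rD_entry, v2rN_entry); ring.

Section Multilinear.
Variable K : fieldType.

Lemma linear_fun0 (V U : vectType K) (g : V -> U) : linear g -> g 0 = 0.
Proof. by move=> gl; have := gl (-1) 0 0; rewrite !scaleN1r oppr0 addr0 addNr. Qed.

Lemma linear_funD (V U : vectType K) (g : V -> U) u v : linear g ->
  g (u + v) = g u + g v.
Proof. by move=> gl; have := gl 1 u v; rewrite !scale1r. Qed.

Lemma linear_funB (V U : vectType K) (g : V -> U) u v : linear g ->
  g (u - v) = g u - g v.
Proof. by move=> gl; have := gl (-1) v u; rewrite !scaleN1r ![- _ + _]addrC. Qed.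

Lemma linear_fun_comb (V U : vectType K) (g : V -> U) n (c : 'I_n -> K) v :
  linear g -> g (\sum_i c i *: v i) = \sum_i c i *: g (v i).
Proof.
move=> gl; elim/big_rec2: _ => [|i a b _ <-]; first exact: linear_fun0.
exact: gl.
Qed.

Lemma tlift_sum_fin (V W U : vectType K) (I J : finType) (h : V -> W -> U)
    (x : I -> J -> V) (y : I -> J -> W) :
  bilin h -> tlift h (\sum_i \sum_j x i j ⊗ y i j) =
             \sum_i \sum_j h (x i j) (y i j).
Proof.
case=> hl hr; rewrite linear_sum; apply: eq_bigr => i _.
by rewrite linear_sum; apply: eq_bigr => j _; exact: tlift_tens.
Qed.

End Multilinear.

(** * The Casimir element of a basis and its dual under the form *)

Section Casimir.
Variables (K : fieldType) (D : quadraticDiassType K).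
Variables (n : nat) (e f : n.-tuple D).
Hypothesis e_basis : basis_of fullv e.
Hypothesis f_dual : forall i j : 'I_n,
  omega (tnth f i) (tnth e j) = (i == j)%:R.

Lemma omega_skew (a b : D) : omega a b = - omega b a.
Proof. by rewrite hermC expr1 mulN1r. Qed.

(** Pairing the expansion of [d] in the basis [e] with f_i leaves exactly the i-th coordinate. *)
Lemma basis_coord (d : D) : d = \sum_i omega (tnth f i) d *: tnth e i.
Proof.
rewrite {1}(coord_basis e_basis (memvf d)); apply: eq_bigr => i _.
rewrite (tnth_nth 0 e); congr (_ *: _).
rewrite {2}(coord_basis e_basis (memvf d)) linear_sumr (bigD1 i) //=.
rewrite big1 ?addr0 => [|j ji]; rewrite linearZr_LR /= -tnth_nth f_dual.
  by rewrite eqxx mulr1.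
by rewrite eq_sym (negbTE ji) mulr0.
Qed.

(** That the f_i span follows from nondegeneracy: the difference of both sides is orthogonal to
    every e_j, hence to all of [D]. *)
Lemma dual_coord (d : D) : d = \sum_i omega d (tnth e i) *: tnth f i.
Proof.
apply/eqP; rewrite -subr_eq0; apply/eqP.
apply: (nondegenerateP _).1; first exact: omega_nondegenerate.
move=> z; rewrite (basis_coord z) linear_sumr big1 //= => j _.
rewrite linearZr_LR /= linearBl linear_sumlz /= (bigD1 j) //= big1.
  by rewrite linearZl_LR /= f_dual eqxx mulr1 addr0 subrr mulr0.
by move=> i ij; rewrite linearZl_LR /= f_dual (negbTE ij) mulr0.
Qed.

(** Expanding g' f_p in [f] and g e_p in [e] turns both sides into the same double sum of h e_p f_q,
    since omega (g' f_p) e_q = omega f_p (g e_q). *)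
Lemma casimir_adjoint (U : vectType K) (h : D -> D -> U) (g g' : D -> D) :
    bilin h -> (forall a b, omega a (g b) = omega (g' a) b) ->
  \sum_p h (tnth e p) (g' (tnth f p)) = \sum_p h (g (tnth e p)) (tnth f p).
Proof.
case=> hl hr gg'.
under eq_bigr => p _ do rewrite (dual_coord (g' _)) linear_fun_comb //.
under [RHS]eq_bigr => p _.
  rewrite (basis_coord (g _)) (linear_fun_comb _ _ (hl _)); over.
rewrite exchange_big; apply: eq_bigr => p _; apply: eq_bigr => q _ /=.
by rewrite gg'.
Qed.

(** Written in the basis [e] alone, the Casimir element has as coefficients the Gram matrix of [f],
    which is antisymmetric. *)
Lemma casimir_skew (U : vectType K) (h : D -> D -> U) : bilin h ->
  \sum_p h (tnth f p) (tnth e p) = - \sum_p h (tnth e p) (tnth f p).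
Proof.
case=> hl hr.
under eq_bigr => p _ do rewrite [X in h X]basis_coord (linear_fun_comb _ _ (hl _)).
under [in RHS]eq_bigr => p _ do
  rewrite [X in h _ X]basis_coord (linear_fun_comb _ _ (hr _)).
rewrite exchange_big -sumrN; apply: eq_bigr => p _; rewrite -sumrN.
by apply: eq_bigr => q _; rewrite omega_skew scaleNr.
Qed.

End Casimir.

Section MultilinearPartial.
Variables (K : fieldType) (V1 V2 V3 U : vectType K).
Variable G : V1 -> V2 -> V3 -> U.
Hypothesis Gl : trilin G.

Lemma trilin12 c : bilin (fun a b => G a b c).
Proof. exact: Gl.1. Qed.

Lemma trilin13 b : bilin (fun a c => G a b c).
Proof. by split=> [c|a]; [case: (Gl.1 c) => + _; exact | exact: Gl.2]. Qed.

Lemma trilin23 a : bilin (G a).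
Proof. by split=> [c|b]; [case: (Gl.1 c) => _; exact | exact: Gl.2]. Qed.

End MultilinearPartial.

Lemma trilin_swap23 (K : fieldType) (V1 V2 V3 U : vectType K)
  (G : V1 -> V2 -> V3 -> U) : trilin G -> trilin (fun a c b => G a b c).
Proof.
by move=> Gl; split=> [b|a c]; [exact: trilin13 | case: (trilin23 Gl a) => + _; exact].
Qed.

Lemma bilin_compl (K : fieldType) (V V' W U : vectType K) (h : V' -> W -> U)
  (g : V -> V') : linear g -> bilin h -> bilin (fun a b => h (g a) b).
Proof. by move=> gl [hl hr]; split=> // w a u v; rewrite gl hl. Qed.

(** * Diassociative products inside Casimir sums *)

Section QuadraticCasimir.
Variables (K : fieldType) (D : quadraticDiassType K).
Variables (n : nat) (e f : n.-tuple D).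
Hypothesis e_basis : basis_of fullv e.
Hypothesis f_dual : forall i j : 'I_n,
  omega (tnth f i) (tnth e j) = (i == j)%:R.
Variable U : vectType K.

Section Two.
Variable h : D -> D -> U.
Hypothesis hl : bilin h.
Notation E p := (tnth e p).
Notation F p := (tnth f p).

(** This and the next three lemmas compute the omega-adjoints of the multiplication operators. For
    right multiplications they are read off [omega_right] and [omega_left]; for left ones, skewness
    of the form is used as well. *)
Lemma casimir_lright d :
  \sum_p h (E p) (d ⊢ F p) = \sum_p h (E p ⊣ d) (F p).
Proof.
apply: (casimir_adjoint e_basis f_dual (g := fun b => b ⊣ d) hl) => a b.
by rewrite omega_skew omega_left -omega_skew.
Qed.

Lemma casimir_lleft d :
  \sum_p h (E p) (d ⊣ F p) = \sum_p h (E p ⊣ d - E p ⊢ d) (F p).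
Proof.
apply: (casimir_adjoint e_basis f_dual (g := fun b => b ⊣ d - b ⊢ d) hl) => a b.
rewrite linearBr /= (omega_skew a) (omega_skew a (b ⊢ d)) (omega_skew _ b).
by rewrite omega_left omega_right linearBr opprK addKr.
Qed.

Lemma casimir_rright d :
  \sum_p h (E p) (F p ⊢ d) = \sum_p h (d ⊢ E p - d ⊣ E p) (F p).
Proof.
apply: (casimir_adjoint e_basis f_dual (g := fun b => d ⊢ b - d ⊣ b)
  (g' := fun a => a ⊢ d) hl) => a b.
by rewrite omega_right.
Qed.

Lemma casimir_rleft d :
  \sum_p h (E p) (F p ⊣ d) = \sum_p h (d ⊢ E p) (F p).
Proof.
apply: (casimir_adjoint e_basis f_dual (g := fun b => d ⊢ b)
  (g' := fun a => a ⊣ d) hl) => a b.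
by rewrite omega_left.
Qed.

End Two.

Section Three.
Variable F : D -> D -> D -> U.
Hypothesis Fl : trilin F.
Let Tr := \sum_p \sum_q F (tnth e p ⊢ tnth e q) (tnth f p) (tnth f q).
Let Tl := \sum_p \sum_q F (tnth e p ⊣ tnth e q) (tnth f p) (tnth f q).

(** Multiplication by f_q is traded from f_p to e_p, which puts f_q into the first slot; skewness of
    the Casimir element in q then exchanges it with e_q, at the cost of a sign. *)
Lemma casimir3_right3 :
  \sum_p \sum_q F (tnth e p) (tnth e q) (tnth f p ⊢ tnth f q) = Tl - Tr.
Proof.
rewrite exchange_big.
under eq_bigr => q _ do rewrite (casimir_rright (trilin13 Fl _)).
rewrite exchange_big.
under eq_bigr => p _.
  rewrite (casimir_skew e_basis f_dual
    (h := fun a b => F (a ⊢ tnth e p - a ⊣ tnth e p) b (tnth f p))); last first.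
    apply: (bilin_compl _ (trilin12 Fl _)) => a u v.
    by rewrite !linearPl scalerBr opprD addrACA.
  over.
rewrite sumrN exchange_big -opprB; congr (- _); rewrite -sumrB.
apply: eq_bigr => p _; rewrite -sumrB; apply: eq_bigr => q _ /=.
by rewrite (linear_funB _ _ ((trilin12 Fl _).1 _)).
Qed.

Lemma casimir3_left3 :
  \sum_p \sum_q F (tnth e p) (tnth e q) (tnth f p ⊣ tnth f q) = - Tr.
Proof.
rewrite exchange_big.
under eq_bigr => q _ do rewrite (casimir_rleft (trilin13 Fl _)).
rewrite exchange_big.
under eq_bigr => p _.
  rewrite (casimir_skew e_basis f_dual
    (h := fun a b => F (a ⊢ tnth e p) b (tnth f p))); last first.
    apply: (bilin_compl _ (trilin12 Fl _)) => a u v.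
    by rewrite linearPl.
  over.
by rewrite sumrN exchange_big.
Qed.

(** The multiplier is already some e_p, so one trade in q and a renaming of indices suffice. *)
Lemma casimir3_right2 :
  \sum_p \sum_q F (tnth e q) (tnth e p ⊢ tnth f q) (tnth f p) = Tl.
Proof.
under eq_bigr => p _ do rewrite (casimir_lright (trilin12 Fl _)).
by rewrite exchange_big.
Qed.

Lemma casimir3_left2 :
  \sum_p \sum_q F (tnth e q) (tnth e p ⊣ tnth f q) (tnth f p) = Tl - Tr.
Proof.
under eq_bigr => p _ do rewrite (casimir_lleft (trilin12 Fl _)).
rewrite exchange_big -sumrB; apply: eq_bigr => p _.
rewrite -sumrB; apply: eq_bigr => q _ /=.
by rewrite (linear_funB _ _ ((trilin12 Fl _).1 _)).
Qed.

End Three.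
End QuadraticCasimir.

(** * The Zinbiel equation and invariance, evaluated on multilinear maps *)

Section Zinbiel.
Variables (K : fieldType) (B : zinbielType K) (m : nat) (x y : 'I_m -> B).
Let r : tensor B B := \sum_i x i ⊗ y i.

(** The linear map on triple tensors induced by [G] is applied to the equation. Later [G] is a
    Casimir sum over [D] with three free arguments in [B]. *)
Lemma zybe_trilin (U : vectType K) (G : B -> B -> B -> U) : trilin G ->
  zybe r -> \sum_i \sum_j
    (  G (x i ◇ y j) (x j) (y i) + G (y i ◇ x j) (x i) (y j)
     + G (x i) (y i ◇ x j) (y j) + G (x j) (x i ◇ y j) (y i)
     - G (x i) (x j) (y i ◇ y j) - G (x j) (x i) (y i ◇ y j)
     - G (x i ◇ x j) (y j) (y i) - G (y j) (x i ◇ x j) (y i)) = 0.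
Proof.
move=> Gl; rewrite /zybe zybe_lhs_sum.
pose L := tlift (fun (t : tensor B B) c => tlift (fun a b => G a b c) t).
have LE a b c : L (a ⊗ b ⊗ c) = G a b c.
  rewrite /L tlift_tens => [|c' k u v|t k u v]; last 2 first.
  - by rewrite linearP.
  - by apply: tlift_fun => a' b'; rewrite Gl.2.
  by apply: tlift_tens; case: (Gl.1 c).
move/(congr1 L); rewrite /L linear0 => L0; rewrite -[RHS]L0.
rewrite linear_sum; apply: eq_bigr => i _.
rewrite linear_sum; apply: eq_bigr => j _.
by rewrite !(linearD, linearN) /= -/L !LE.
Qed.

Lemma zinb_invariant_bilin (U : vectType K) (h : B -> B -> U) b : bilin h ->
    zinb_invariant (r - tau r) -> \sum_i (
      h (b ◇ x i) (y i) - h (b ◇ y i) (x i)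
    - h (x i) (b ◇ y i + y i ◇ b) + h (y i) (b ◇ x i + x i ◇ b)) = 0.
Proof.
move=> hl inv.
have tlift_skew (W : vectType K) (k : B -> B -> W) : bilin k ->
    tlift k (r - tau r) = \sum_i (k (x i) (y i) - k (y i) (x i)).
  case=> kl kr; rewrite /r tau_sum -sumrB linear_sum; apply: eq_bigr => i _.
  by rewrite linearB /= !tlift_tens.
have := inv b; rewrite /= /tmap !tlift_skew; try by split=> ?; lin.
rewrite -sumrB => /(congr1 (tlift h)); rewrite linear0 => h0.
rewrite -[RHS]h0 linear_sum; apply: eq_bigr => i _ /=.
rewrite !linearB /= !tlift_tens; try by [case: hl].
by rewrite opprK addrA.
Qed.

End Zinbiel.

Section ZinbielConsequences.
Variables (K : fieldType) (B : zinbielType K) (m : nat) (x y : 'I_m -> B).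
Let r : tensor B B := \sum_i x i ⊗ y i.

(** Certificate format for the two coefficient identities below: [Z] carries the Zinbiel equation,
    [I] the invariance for a fixed i, and [D] the terms that cancel by exchanging i and j. *)
Lemma double_sum_eq0 (U : zmodType) (F Z I D : 'I_m -> 'I_m -> U) :
    \sum_i \sum_j Z i j = 0 -> (forall i, \sum_j I i j = 0) ->
    (forall i j, F i j = Z i j + I i j + (D i j - D j i)) ->
  \sum_i \sum_j F i j = 0.
Proof.
move=> Z0 I0 FE; under eq_bigr => i _ do under eq_bigr => j _ do rewrite FE.
under eq_bigr => i _ do rewrite !big_split /= I0 addr0 sumrN.
by rewrite !big_split /= Z0 add0r sumrN [X in _ - X]exchange_big subrr.
Qed.

Lemma bilinC (V W U : vectType K) (h : V -> W -> U) :
  bilin h -> bilin (fun b a => h a b).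
Proof. by case. Qed.

Variables (U : vectType K) (G : B -> B -> B -> U).
Hypotheses (Gl : trilin G) (rZ : zybe r) (rinv : zinb_invariant (r - tau r)).

(** Invariance is used for b = x_i on the first two slots in reversed order, with y_i in the
    third. *)
Lemma zybe_right_coef : \sum_i \sum_j
  (G (x i ◇ x j) (y i) (y j) - G (x i) (x j) (y i ◇ y j)
   - G (x i) (x j) (y j ◇ y i) + G (x j) (y j ◇ x i) (y i)) = 0.
Proof.
apply: (double_sum_eq0 (zybe_trilin Gl rZ)
  (fun i => zinb_invariant_bilin (x i) (bilinC (trilin12 Gl (y i))) rinv)
  (* What remains after subtracting [Z] and [I] pairs off under the exchange of i and j; [D] holds
     one term of each pair. *)
  (D := fun i j =>
  G (x j) (y j ◇ x i) (y i) - G (x i) (x j) (y j ◇ y i)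
  + G (y j ◇ x i) (x j) (y i) - G (x j ◇ x i) (y j) (y i))) => i j /=.
rewrite !(linear_funD _ _ ((trilin12 Gl _).1 _)).
vect_ring.
Qed.

(** Two instances of invariance enter with opposite signs: b = x_i on slots one and three, with y_i
    in the second, and b = y_i on slots two and three, with x_i in the first. The Zinbiel equation
    is taken with slots two and three exchanged. *)
Lemma zybe_left_coef : \sum_i \sum_j
  (G (x j ◇ x i) (y i) (y j) + G (x i) (x j) (y i ◇ y j)
   - G (x j) (x i ◇ y j) (y i) - G (x j) (y j ◇ x i) (y i)) = 0.
Proof.
have I0 i := congr2 (fun a b => a - b)
  (zinb_invariant_bilin (x i) (bilinC (trilin13 Gl (y i))) rinv)
  (zinb_invariant_bilin (y i) (bilinC (trilin23 Gl (x i))) rinv).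
rewrite /= subr0 in I0; setoid_rewrite <- sumrB in I0.
apply: (double_sum_eq0 (zybe_trilin (trilin_swap23 Gl) rZ) I0 (D := fun i j =>
  G (y j ◇ x i) (y i) (x j) - G (x j) (y j ◇ x i) (y i)
  - G (x i) (y j ◇ y i) (x j) + G (x i) (x j ◇ y i) (y j))) => i j /=.
rewrite !(linear_funD _ _ ((trilin13 Gl _).1 _)).
rewrite !(linear_funD _ _ ((trilin23 Gl _).1 _)).
vect_ring.
Qed.

End ZinbielConsequences.

(** The arguments in [D] and in [B] are kept apart, here and in [tens3], so that Casimir rules apply
    for fixed elements of [B] and Zinbiel identities for fixed elements of [D]. *)
Definition tens2 (K : fieldType) (D B : vectType K) (d1 d2 : D) (a b : B) :=
  (d1 ⊗ a) ⊗ (d2 ⊗ b).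

Definition tens3 (K : fieldType) (D B : vectType K)
  (d1 d2 d3 : D) (a b c : B) := tens2 d1 d2 a b ⊗ (d3 ⊗ c).

Section Tens.
Variables (K : fieldType) (D B : vectType K).

Lemma tens2_bilinr (d1 d2 : D) : bilin (tens2 d1 d2 : B -> B -> _).
Proof. by split=> ?; rewrite /tens2; lin. Qed.

Lemma tens2_bilinl (a b : B) : bilin (fun d1 d2 : D => tens2 d1 d2 a b).
Proof. by split=> ?; rewrite /tens2; lin. Qed.

Lemma tens3_trilinr (d1 d2 d3 : D) :
  trilin (tens3 d1 d2 d3 : B -> B -> B -> _).
Proof. by split=> [c|a b]; first split=> ?; rewrite /tens3 /tens2; lin. Qed.

Lemma tens3_trilinl (a b c : B) :
  trilin (fun d1 d2 d3 : D => tens3 d1 d2 d3 a b c).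
Proof. by split=> [?|? ?]; first split=> ?; rewrite /tens3 /tens2; lin. Qed.

End Tens.

Lemma bilin_sum (K : fieldType) (V W U : vectType K) (I : finType)
    (h : I -> V -> W -> U) :
  (forall i, bilin (h i)) -> bilin (fun v w => \sum_i h i v w).
Proof.
move=> hb; split=> w a u v; rewrite scaler_sumr -big_split; apply: eq_bigr => i _.
  exact: (hb i).1.
exact: (hb i).2.
Qed.

Lemma trilin_sum (K : fieldType) (V1 V2 V3 U : vectType K) (I : finType)
    (G : I -> V1 -> V2 -> V3 -> U) :
  (forall i, trilin (G i)) -> trilin (fun a b c => \sum_i G i a b c).
Proof.
move=> Gt; split=> [c|a b s u v]; first by apply: bilin_sum => i; exact: (Gt i).1.
by rewrite scaler_sumr -big_split; apply: eq_bigr => i _; exact: (Gt i).2.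
Qed.

Lemma amul_tens (K : fieldType) (D : diassType K) (B : zinbielType K)
    (d1 d2 : D) (b1 b2 : B) :
  (d1 ⊗ b1 : tensor D B) • (d2 ⊗ b2) =
  (d1 ⊢ d2) ⊗ (b1 ◇ b2) + (d1 ⊣ d2) ⊗ (b2 ◇ b1).
Proof. exact: ind_mul_tens. Qed.

(** * The associative Yang-Baxter equation and ass-invariance for [rhat] *)

Section Main.
Variables (K : fieldType) (B : zinbielType K) (D : quadraticDiassType K).
Variables (m : nat) (x y : 'I_m -> B) (n : nat) (e f : n.-tuple D).
Hypothesis e_basis : basis_of fullv e.
Hypothesis f_dual : forall i j : 'I_n,
  omega (tnth f i) (tnth e j) = (i == j)%:R.
Let r : tensor B B := \sum_i x i ⊗ y i.
Let rhat : tensor (tensor D B) (tensor D B) :=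
  \sum_(i < m) \sum_(j < n) (tnth e j ⊗ x i) ⊗ (tnth f j ⊗ y i).

(** The flip exchanges e_j with f_j and x_i with y_i; skewness of the Casimir element undoes the
    first exchange up to sign. *)
Lemma tau_rhat :
  tau rhat = - \sum_i \sum_j (tnth e j ⊗ y i) ⊗ (tnth f j ⊗ x i).
Proof.
rewrite /rhat /tau tlift_sum_fin; last by split=> ?; lin.
rewrite -sumrN; apply: eq_bigr => i _.
exact: (casimir_skew e_basis f_dual (tens2_bilinl D (y i) (x i))).
Qed.

(** [Sr] and [Sl] are the sums R and L with elements of [B] attached to the three factors. *)
Let Sr a b c :=
  \sum_p \sum_q tens3 (tnth e p ⊢ tnth e q) (tnth f p) (tnth f q) a b c
    : tensor (tensor (tensor D B) (tensor D B)) (tensor D B).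
Let Sl a b c :=
  \sum_p \sum_q tens3 (tnth e p ⊣ tnth e q) (tnth f p) (tnth f q) a b c
    : tensor (tensor (tensor D B) (tensor D B)) (tensor D B).

Lemma aybe_rhat_expand : aybe_lhs rhat = \sum_i \sum_j
  ((Sr (x i ◇ x j) (y i) (y j) - Sr (x i) (x j) (y i ◇ y j)
    - Sr (x i) (x j) (y j ◇ y i) + Sr (x j) (y j ◇ x i) (y i))
 + (Sl (x j ◇ x i) (y i) (y j) + Sl (x i) (x j) (y i ◇ y j)
   - Sl (x j) (x i ◇ y j) (y i) - Sl (x j) (y j ◇ x i) (y i))).
Proof.
rewrite /aybe_lhs /rhat tlift_sum_fin; last by split=> ?; lin.
apply: eq_bigr => i _.
under eq_bigr => p _.
  rewrite tlift_sum_fin; last by split=> ?; lin.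
  over.
rewrite exchange_big; apply: eq_bigr => j _ /=.
transitivity (\sum_p \sum_q
  (tens3 (tnth e p ⊢ tnth e q) (tnth f p) (tnth f q) (x i ◇ x j) (y i) (y j)
 + tens3 (tnth e p ⊣ tnth e q) (tnth f p) (tnth f q) (x j ◇ x i) (y i) (y j)
 + tens3 (tnth e p) (tnth e q) (tnth f p ⊢ tnth f q) (x i) (x j) (y i ◇ y j)
 + tens3 (tnth e p) (tnth e q) (tnth f p ⊣ tnth f q) (x i) (x j) (y j ◇ y i)
 - tens3 (tnth e q) (tnth e p ⊢ tnth f q) (tnth f p) (x j) (x i ◇ y j) (y i)
 - tens3 (tnth e q) (tnth e p ⊣ tnth f q) (tnth f p) (x j) (y j ◇ x i) (y i))).
  apply: eq_bigr => p _; apply: eq_bigr => q _.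
  rewrite !amul_tens /tens3 /tens2 !(linearDl, linearDr) /=.
  by rewrite opprD !addrA.
under eq_bigr => p _ do rewrite !(big_split, sumrN) /=.
rewrite !(big_split, sumrN) /=.
(* The first two sums already are values of [Sr] and [Sl]; the other four are reduced to such
   values. *)
rewrite (casimir3_right3 e_basis f_dual
  (tens3_trilinl D (x i) (x j) (y i ◇ y j))).
rewrite (casimir3_left3 e_basis f_dual
  (tens3_trilinl D (x i) (x j) (y j ◇ y i))).
rewrite (casimir3_right2 e_basis f_dual
  (tens3_trilinl D (x j) (x i ◇ y j) (y i))).
rewrite (casimir3_left2 e_basis f_dual
  (tens3_trilinl D (x j) (y j ◇ x i) (y i))).
have regroup (V : vectType K) (a1 a2 a3 a4 b1 b2 b3 b4 : V) :
  a1 + b1 + (b2 - a2) - a3 - b3 - (b4 - a4) =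
  (a1 - a2 - a3 + a4) + (b1 + b2 - b3 - b4) by vect_ring.
exact: regroup.
Qed.

Hypotheses (rZ : zybe r) (rinv : zinb_invariant (r - tau r)).

Lemma aybe_rhat : aybe rhat.
Proof.
rewrite /aybe aybe_rhat_expand.
under eq_bigr => i _ do rewrite big_split.
rewrite big_split /=.
(* [Sr] and [Sl] are trilinear in [B], so they may serve as the map [G] of the two coefficient
   identities. *)
rewrite (zybe_right_coef _ rZ rinv) ?(zybe_left_coef _ rZ rinv) ?addr0 //.
all: by apply: trilin_sum => p; apply: trilin_sum => q; exact: tens3_trilinr.
Qed.

Lemma ass_invariant_rhat : ass_invariant (rhat + tau rhat).
Proof.
move=> a; pose k (a u v : tensor D B) := u ⊗ (a • v) - (u • a) ⊗ v.
rewrite -/(k a); move: a; apply: tensor_ext => [||d b].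
- by lin.
- by move=> c u v; rewrite scaler0 addr0.
rewrite linearD tau_rhat linearN /= /rhat !tlift_sum_fin; try by split=> ?; lin.
pose h (d1 d2 : 'I_n -> D) u v : tensor (tensor D B) (tensor D B) :=
  \sum_p tens2 (d1 p) (d2 p) u v.
have hb d1 d2 : bilin (h d1 d2).
  by apply: bilin_sum => p; exact: tens2_bilinr.
pose hl := h (fun p => tnth e p ⊣ d) (tnth f).
pose hr := h (fun p => tnth e p ⊢ d) (tnth f).
(* Trading moves every multiplication by [d] onto e_p, leaving only the two bilinear maps [hl] and
   [hr]. *)
have kE u v : \sum_p k (d ⊗ b) (tnth e p ⊗ u) (tnth f p ⊗ v) =
    hl u (b ◇ v) + hl u (v ◇ b) - hr u (v ◇ b) - hr (u ◇ b) v - hl (b ◇ u) v.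
  transitivity (\sum_p
    (tens2 (tnth e p) (d ⊢ tnth f p) u (b ◇ v)
   + tens2 (tnth e p) (d ⊣ tnth f p) u (v ◇ b)
   - tens2 (tnth e p ⊢ d) (tnth f p) (u ◇ b) v
   - tens2 (tnth e p ⊣ d) (tnth f p) (b ◇ u) v)).
    apply: eq_bigr => p _.
    rewrite /k !amul_tens /tens2 !(linearDl, linearDr) /=.
    by rewrite opprD !addrA.
  rewrite !(big_split, sumrN) /=.
  rewrite (casimir_lright e_basis f_dual (tens2_bilinl D _ _)).
  rewrite (casimir_lleft e_basis f_dual (tens2_bilinl D _ _)).
  under [X in _ + X - _ - _]eq_bigr => p _ do
    rewrite (linear_funB _ _ ((tens2_bilinl D _ _).1 _)).
  by rewrite sumrB !addrA.
under eq_bigr => i _ do rewrite kE.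
under [X in _ - X]eq_bigr => i _ do rewrite kE.
rewrite -sumrB.
have [hlb hrb] : bilin hl /\ bilin hr by split; exact: hb.
(* From here on only the bilinearity of [hl] and [hr] matters. *)
clearbody hl hr; clear kE.
have Il := zinb_invariant_bilin b hlb rinv.
have Ir := zinb_invariant_bilin b hrb rinv.
have Ir' := zinb_invariant_bilin b (bilinC hrb) rinv.
(* The goal is the combination Ir - Ir' - Il: the last gives all terms in [hl], and in Ir - Ir' the
   terms in [hr] with [b] acting from the left cancel. *)
have := congr2 (fun s t => s - t) (congr2 (fun s t => s - t) Ir Ir') Il.
rewrite /= !subr0 => I0; rewrite -[RHS]I0 -!sumrB.
apply: eq_bigr => i _.
rewrite !(linear_funD _ _ (hlb.2 _)) !(linear_funD _ _ (hrb.1 _)).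
rewrite !(linear_funD _ _ (hrb.2 _)).
vect_ring.
Qed.

End Main.

Theorem proposition4p19 (K : fieldType) (charK : [pchar K] =i pred0)
    (B : zinbielType K) (D : quadraticDiassType K)
    (m : nat) (x y : 'I_m -> B)
    (n : nat) (e f : n.-tuple D)
    (e_basis : basis_of fullv e)
    (f_dual : forall i j : 'I_n,
       omega (tnth f i) (tnth e j) = (i == j)%:R) :
  let r : tensor B B := \sum_(i < m) x i ⊗ y i in
  let rhat : tensor (tensor D B) (tensor D B) :=
    \sum_(i < m) \sum_(j < n)
      (tnth e j ⊗ x i) ⊗ (tnth f j ⊗ y i) in
  zybe r ->
  (zinb_invariant (r - tau r) -> aybe rhat /\ ass_invariant (rhat + tau rhat))
  /\ (tau r = r -> aybe rhat /\ tau rhat = - rhat).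
Proof.
move=> r rhat rZ; split=> [rinv|rsym].
  by split; [exact: aybe_rhat | exact: ass_invariant_rhat].
split; first apply: aybe_rhat => //.
  by rewrite -/r rsym subrr => b; rewrite /= /tmap !(linear0 (tlift _)) subrr.
rewrite (tau_rhat _ _ e_basis f_dual); congr (- _); rewrite /rhat.
rewrite exchange_big [RHS]exchange_big; apply: eq_bigr => j _ /=.
have [hl hr] := tens2_bilinr B (tnth e j) (tnth f j).
(* For each fixed j, the map sending u ⊗ v to (e_j ⊗ u) ⊗ (f_j ⊗ v) carries the symmetry of [r] over
   to the j-th summand. *)
move: rsym; rewrite tau_sum => /(congr1 (tlift (tens2 (tnth e j) (tnth f j)))).
by rewrite !tlift_sum.
Qed.
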